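(* Let $M$ be a pointed metric space such that the set $M'$ of cluster points of $M$ is infinite, and let $X$ be a non-zero Banach space. Then the norm of the bidual $(\mathcal F(M)\widehat{\otimes}_\pi X)^{**}$ is octahedral.
   Context: All Banach spaces are real. $\mathcal F(M)$ is the Lipschitz-free space over $M$ (closed linear span of evaluation functionals $\delta_p$ in the dual of the space $\mathrm{Lip}_0(M)$ of real Lipschitz functions vanishing at the base point), $\widehat{\otimes}_\pi$ is the projective tensor product. A Banach space $Z$ is octahedral if for every $x_1,\dots,x_n\in S_Z$ and $\varepsilon>0$ there is $y\in S_Z$ with $\|x_i-y\|\ge 2-\varepsilon$ for all $i$. *)

(* Defs.v *)
From mathcomp Require Import all_boot all_algebra all_classical all_reals all_analysis.
From Stdlib Require List.
Import GRing.Theory Num.Theory.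
Set Implicit Arguments. Unset Strict Implicit. Unset Printing Implicit Defensive.
Local Open Scope ring_scope.
Local Open Scope classical_set_scope.

Section Defs.
Variable R : realType.

(* A normed space is given as a linear subset S of an lmodType V with a norm N. *)

Definition lin_on {V : lmodType R} (S : set V) (phi : V -> R) : Prop :=
  forall (a : R) (u v : V), S u -> S v -> phi (a *: u + v) = a * phi u + phi v.

Definition dual_set {V : lmodType R} (S : set V) (N : V -> R) : set (V -> R) :=
  [set phi | lin_on S phi /\ exists C : R, forall u, S u -> `|phi u| <= C * N u].

Definition dual_norm {V : lmodType R} (S : set V) (N : V -> R) (phi : V -> R) : R :=
  sup [set `|phi u| | u in [set u | S u /\ N u <= 1]].

Definition bidual_set {V : lmodType R} (S : set V) (N : V -> R) :=
  dual_set (dual_set S N) (dual_norm S N).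
Definition bidual_norm {V : lmodType R} (S : set V) (N : V -> R) :=
  dual_norm (dual_set S N) (dual_norm S N).

Definition closed_span {V : lmodType R} (S : set V) (N : V -> R) (G : set V)
  : set V :=
  [set v | S v /\ forall e : R, 0 < e -> exists s : seq (R * V),
      (forall c, List.In c s -> G c.2) /\ N (v - \sum_(c <- s) c.1 *: c.2) < e].

Definition octahedral {V : lmodType R} (S : set V) (N : V -> R) : Prop :=
  forall (xs : seq V) (e : R), 0 < e ->
    (forall x, List.In x xs -> S x /\ N x = 1) ->
    exists y, S y /\ N y = 1 /\ forall x, List.In x xs -> 2 - e <= N (x - y).

Variable M : Type.

Definition is_metric (d : M -> M -> R) : Prop :=
  [/\ forall x y, 0 <= d x y,
      forall x y, d x y = 0 <-> x = y,
      forall x y, d x y = d y x &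
      forall x y z, d x z <= d x y + d y z].

Definition cluster_points (d : M -> M -> R) : set M :=
  [set p | forall e : R, 0 < e -> exists q, q <> p /\ d p q < e].

Definition Lip0 (d : M -> M -> R) (p0 : M) : set (M -> R) :=
  [set f | f p0 = 0 /\ exists L : R, forall x y, `|f x - f y| <= L * d x y].

Definition lip_norm (d : M -> M -> R) (f : M -> R) : R :=
  sup [set `|f xy.1 - f xy.2| / d xy.1 xy.2 | xy in [set xy : M * M | xy.1 <> xy.2]].

Definition delta (p : M) : (M -> R) -> R := fun f => f p.

Definition free_space (d : M -> M -> R) (p0 : M) : set ((M -> R) -> R) :=
  closed_span (dual_set (Lip0 d p0) (lip_norm d)) (dual_norm (Lip0 d p0) (lip_norm d))
    [set delta p | p in setT].

Definition free_norm (d : M -> M -> R) (p0 : M) : ((M -> R) -> R) -> R :=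
  dual_norm (Lip0 d p0) (lip_norm d).

End Defs.

Section Tensor.
Variable R : realType.
Variables (V : lmodType R) (X : normedModType R).

Definition bilin_on (S : set V) (A : V -> X -> R) : Prop :=
  (forall (a : R) z1 z2 x, S z1 -> S z2 -> A (a *: z1 + z2) x = a * A z1 x + A z2 x) /\
  (forall (a : R) z x1 x2, S z -> A z (a *: x1 + x2) = a * A z x1 + A z x2).

(* The algebraic tensor product S (x) X, realised (as in Ryan's book) as the
   linear functionals on the space of bilinear forms on S x X:
   sum_i z_i (x) x_i  acts by  A |-> sum_i A z_i x_i  (0 on non-bilinear A). *)
Definition tens (S : set V) (s : seq (V * X)) : (V -> X -> R) -> R :=
  fun A => if `[< bilin_on S A >] then \sum_(c <- s) A c.1 c.2 else 0.

Definition alg_tensor (S : set V) : set ((V -> X -> R) -> R) :=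
  [set u | exists s : seq (V * X), (forall c, List.In c s -> S c.1) /\ u = tens S s].

Definition proj_norm (S : set V) (N : V -> R) (u : (V -> X -> R) -> R) : R :=
  inf [set r | exists s : seq (V * X), (forall c, List.In c s -> S c.1) /\
          u = tens S s /\ r = \sum_(c <- s) N c.1 * `|c.2|].

End Tensor.

(* Main.v *)
(** The dual of F(M) (x)_pi X is the space of Lipschitz maps from M to X^*
    vanishing at the base point.  Given norm-one bidual elements Phi_i, choose
    1-Lipschitz maps f_i almost norming them.  Near a cluster point p, each f_i can
    be flattened by a logarithmic cutoff at the cost of a factor 1 + e, and on the
    flat part one can add a small bump of slope one in the direction of a norming
    functional of some x0 in the unit sphere of X.  The perturbations at different
    cluster points have disjoint supports, hence all their signed sums are uniformly
    bounded, so at one of sufficiently many cluster points no Phi_i notices the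
    perturbation.  At that point the elementary tensor of a molecule
    (delta_p - delta_v) / d(p, v) with x0 takes the value 1 on every perturbed map,
    and minus this tensor is the required direction. *)
Require Import Defs.
From mathcomp Require Import all_boot all_order all_algebra all_classical all_reals all_analysis.
From mathcomp Require Import ring lra.
Import Order.TTheory GRing.Theory Num.Theory.
Set Implicit Arguments. Unset Strict Implicit. Unset Printing Implicit Defensive.
Local Open Scope ring_scope.
Local Open Scope classical_set_scope.


(** * A norming functional from minimal sublinear functionals *)

Section HahnBanach.
Context {R : realType} {V : lmodType R}.
Implicit Types (q : V -> R) (x y : V).

(** The one-sided form of homogeneity is what passes directly to pointwise infima; equality is
    recovered in [sublinearZ] by scaling back with [t^-1]. *)
Definition sublinear q :=
  (forall x y, q (x + y) <= q x + q y) /\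
  (forall (t : R) x, 0 <= t -> q (t *: x) <= t * q x).

Lemma inf_le_mem (A : set R) (b r : R) :
  (forall s, A s -> b <= s) -> A r -> inf A <= r.
Proof. by move=> Ab Ar; apply: ge_inf => //; exists b. Qed.

Lemma inf_scale_ge (A : set R) (a t : R) : 0 <= t -> A !=set0 ->
  (forall r, A r -> a <= t * r) -> a <= t * inf A.
Proof.
rewrite le_eqVlt => /predU1P[<-|t0] A0 Aa.
  by have [r Ar] := A0; have := Aa r Ar; rewrite !mul0r.
rewrite -ler_pdivrMl//; apply: lb_le_inf => // r Ar.
by rewrite ler_pdivrMl// Aa.
Qed.

Lemma sublinear0 q : sublinear q -> q 0 = 0.
Proof.
move=> [qD qZ]; apply/eqP; rewrite eq_le; apply/andP; split.
  by have := qZ 0 0 (lexx _); rewrite scale0r mul0r.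
by have := qD 0 0; rewrite addr0; lra.
Qed.

Lemma sublinearZ q (t : R) x : sublinear q -> 0 <= t -> q (t *: x) = t * q x.
Proof.
move=> qs; rewrite le_eqVlt => /predU1P[<-|t0].
  by rewrite scale0r mul0r sublinear0.
apply/eqP; rewrite eq_le (qs.2 _ _ (ltW t0)) /= -ler_pdivlMl//.
have := qs.2 t^-1 (t *: x); rewrite scalerA mulVf ?gt_eqF// scale1r; apply.
by rewrite invr_ge0 ltW.
Qed.

Lemma sublinearN_le q x : sublinear q -> - q (- x) <= q x.
Proof.
by move=> qs; have := qs.1 x (- x); rewrite subrr (sublinear0 qs); lra.
Qed.

(* The largest sublinear functional below [q] that is linear along the ray of [y]. *)
Definition ray_inf q y x := inf [set q (x + t *: y) - t * q y | t in [set t : R | 0 <= t]].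

Lemma ray_inf_le q y x (t : R) : sublinear q -> 0 <= t ->
  ray_inf q y x <= q (x + t *: y) - t * q y.
Proof.
(* The set is bounded below by [- q (- x)], because [t * q y = q (t *: y) <= q (x + t *: y) + q (-
   x)]. *)
move=> qs t0; apply: (@inf_le_mem _ (- q (- x))); last by exists t => /=.
move=> _ [s /= s0 <-].
have := qs.1 (x + s *: y) (- x); rewrite addrAC subrr add0r sublinearZ//; lra.
Qed.

Lemma le_ray_inf q y x (a : R) :
  (forall t, 0 <= t -> a <= q (x + t *: y) - t * q y) -> a <= ray_inf q y x.
Proof.
move=> qa; apply: lb_le_inf; last by move=> _ [t /= t0 <-]; apply: qa.
by exists (q (x + 0 *: y) - 0 * q y); exists 0 => /=.
Qed.

(** Parameters [t1] for [x1] and [t2] for [x2] combine to [t1 + t2] for the sum; a parameter [s] for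
    [x] becomes [t * s] for [t *: x]. *)
Lemma sublinear_ray_inf q y : sublinear q -> sublinear (ray_inf q y).
Proof.
move=> qs; split=> [x1 x2|t x t0].
  rewrite -lerBlDr; apply: le_ray_inf => t1 t10.
  rewrite lerBlDr [leRHS]addrC -lerBlDr; apply: le_ray_inf => t2 t20.
  have := @ray_inf_le q y (x1 + x2) (t1 + t2) qs (addr_ge0 t10 t20).
  rewrite scalerDl addrACA; have := qs.1 (x1 + t1 *: y) (x2 + t2 *: y); lra.
apply: inf_scale_ge => // [|_ [s /= s0 <-]].
  by exists (q (x + 0 *: y) - 0 * q y); exists 0 => /=.
have := @ray_inf_le q y (t *: x) (t * s) qs (mulr_ge0 t0 s0).
rewrite -scalerA -scalerDr (sublinearZ _ qs)//; lra.
Qed.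

Lemma ray_inf_le_self q y x : sublinear q -> ray_inf q y x <= q x.
Proof.
by move=> qs; have := @ray_inf_le q y x 0 qs (lexx _); rewrite scale0r addr0 mul0r subr0.
Qed.

Lemma ray_infN q y : sublinear q -> ray_inf q y (- y) <= - q y.
Proof.
move=> qs; have := @ray_inf_le q y (- y) 1 qs ler01.
by rewrite scale1r addNr sublinear0// mul1r sub0r.
Qed.

(** Zorn's lemma for the reversed pointwise order. A nonempty chain is bounded by its pointwise
    infimum, which is finite because a sublinear functional below [p] is at least [- p (- x)] at
    [x]. *)
Lemma minimal_sublinear p : sublinear p ->
  exists q, [/\ sublinear q, (forall x, q x <= p x) &
    forall q', sublinear q' -> (forall x, q' x <= q x) -> q' = q].
Proof.
move=> ps.
pose T := {q : V -> R | sublinear q /\ forall x, q x <= p x}.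
pose rT (s t : T) := `[< forall x, sval t x <= sval s x >].
have rTP s t : rT s t -> forall x, sval t x <= sval s x by move/asboolP.
have eqT (s t : T) : sval s = sval t -> s = t.
  by case: s t => [s sP] [t tP] /= st; move: tP; rewrite -st => tP; congr exist.
have [||||[q [qs qp]] qmin] := @Zorn T rT.
- by move=> t; apply/asboolP.
- by move=> r s t /rTP h1 /rTP h2; apply/asboolP => x; apply: le_trans (h1 x).
- move=> s t /rTP h1 /rTP h2; apply: eqT; apply/funext => x.
  by apply/eqP; rewrite eq_le h1 h2.
- move=> A totA; have [->|/set0P[t0 At0]] := eqVneq A set0.
    have pp x : p x <= p x by [].
    by exists (exist _ p (conj ps pp)).
  pose I x := [set sval t x | t in A].
  have ne x : I x !=set0 by exists (sval t0 x), t0.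
  have inf_le t x : A t -> inf (I x) <= sval t x.
    move=> At; apply: (@inf_le_mem _ (- p (- x))); last by exists t.
    move=> _ [[s [ss sp]] As /= <-].
    by apply: le_trans (sublinearN_le _ ss); rewrite lerN2.
  have infs : sublinear (fun x => inf (I x)).
    split=> [x y|t x t0'].
      rewrite -lerBlDr; apply: lb_le_inf => // _ [s As <-].
      rewrite lerBlDr [leRHS]addrC -lerBlDr; apply: lb_le_inf => // _ [t At <-].
      rewrite lerBlDr; have [/rTP st|/rTP st] := totA _ _ As At.
        apply: le_trans (inf_le _ _ At) _; apply: le_trans (proj1 (proj1 (svalP t)) _ _) _.
        by rewrite addrC lerD2l.
      apply: le_trans (inf_le _ _ As) _; apply: le_trans (proj1 (proj1 (svalP s)) _ _) _.
      by rewrite addrC lerD2r.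
    apply: inf_scale_ge => // _ [s As <-].
    by apply: le_trans (inf_le _ _ As) _; apply: (proj2 (proj1 (svalP s))).
  have infp x : inf (I x) <= p x.
    by apply: le_trans (inf_le _ x At0) _; apply: (proj2 (svalP t0)).
  exists (exist _ (fun x => inf (I x)) (conj infs infp)) => s As; apply/asboolP => x /=.
  exact: inf_le.
exists q; split=> // q' q's q'q.
have q'p x : q' x <= p x by apply: le_trans (q'q x) (qp x).
have q'T : rT (exist _ q (conj qs qp)) (exist _ q' (conj q's q'p)) by apply/asboolP.
by have [] := qmin _ q'T.
Qed.

(** Minimality forces [ray_inf q x = q], so [ray_infN] gives [q (- x) <= - q x]. Hence [q] is odd,
    and an odd sublinear functional is linear. *)
Lemma minimal_sublinear_linear q : sublinear q ->
  (forall q', sublinear q' -> (forall x, q' x <= q x) -> q' = q) ->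
  forall (a : R) x y, q (a *: x + y) = a * q x + q y.
Proof.
move=> qs qmin.
have qN x : q (- x) = - q x.
  apply/eqP; rewrite eq_le; apply/andP; split; last first.
    by have := sublinearN_le (- x) qs; rewrite opprK; lra.
  rewrite -{1}(qmin (ray_inf q x)) ?ray_infN//; first exact: sublinear_ray_inf.
  by move=> z; apply: ray_inf_le_self.
have qZ a x : q (a *: x) = a * q x.
  have [a0|a0] := leP 0 a; first exact: sublinearZ.
  by rewrite -[a]opprK scaleNr qN (sublinearZ _ qs) ?mulNr// oppr_ge0 ltW.
move=> a x y; rewrite -qZ; apply/eqP; rewrite eq_le qs.1 /=.
by have := qs.1 (a *: x + y) (- y); rewrite addrK qN; lra.
Qed.

End HahnBanach.

(** The minimal functional is taken below [ray_inf] of the norm along [x0] instead of below the norm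
    itself: this forces the value at [- x0] to be at most [- |x0|]. *)
Lemma norming_functional (R : realType) (X : normedModType R) (x0 : X) :
  exists xs : X -> R, [/\ forall (a : R) x y, xs (a *: x + y) = a * xs x + xs y,
    forall x, `|xs x| <= `|x| & xs x0 = `|x0|].
Proof.
have ns : sublinear (fun x : X => `|x|).
  split=> [x y|t x t0]; first exact: ler_normD.
  by rewrite normrZ ger0_norm.
have [q [qs qle qmin]] := minimal_sublinear (sublinear_ray_inf x0 ns).
have ql := minimal_sublinear_linear qs qmin.
have q1 x : q x <= `|x| by apply: le_trans (qle x) _; apply: ray_inf_le_self.
have qN x : q (- x) = - q x.
  by have := ql (-1) x 0; rewrite scaleN1r addr0 sublinear0// addr0 mulN1r.
exists q; split=> //.
  by move=> x; rewrite ler_norml q1 andbT lerNl -qN -normrN.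
apply/eqP; rewrite eq_le q1 /= -lerN2 -qN.
by apply: le_trans (qle _) _; apply: ray_infN.
Qed.

(** * Duals of seminormed spaces *)

Section SeminormedDual.
Context {R : realType} {V : lmodType R}.
Implicit Types (S : set V) (N : V -> R) (phi psi : V -> R).

(** The common setting for the Lipschitz space, the free space, the tensor product and their duals,
    so that one set of duality lemmas serves them all. *)
Definition seminormed S N :=
  [/\ S 0, (forall (a : R) u v, S u -> S v -> S (a *: u + v)),
      (forall u, S u -> 0 <= N u) & (forall (a : R) u, S u -> N (a *: u) <= `|a| * N u)].

Lemma seminormedZ S N (a : R) u : seminormed S N -> S u -> S (a *: u).
Proof. by move=> [S0 SD _ _] Su; rewrite -[_ *: _]addr0; apply: SD. Qed.

Lemma seminormedB S N u v : seminormed S N -> S u -> S v -> S (u - v).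
Proof. by move=> [S0 SD _ _] Su Sv; rewrite addrC -scaleN1r; apply: SD. Qed.

Lemma seminormed0 S N : seminormed S N -> N 0 = 0.
Proof.
move=> [S0 _ N0 NZ]; apply/eqP; rewrite eq_le N0// andbT.
by have := NZ 0 0 S0; rewrite scale0r normr0 mul0r.
Qed.

Lemma lin_on0 S phi : S 0 -> lin_on S phi -> phi 0 = 0.
Proof. by move=> S0 /(_ 1 0 0 S0 S0); rewrite scale1r addr0 mul1r; lra. Qed.

Lemma lin_onZ S phi (a : R) u : S 0 -> lin_on S phi -> S u -> phi (a *: u) = a * phi u.
Proof.
by move=> S0 pl Su; rewrite -[_ *: _]addr0 pl// (lin_on0 S0 pl) addr0.
Qed.

Lemma lin_onB S phi u v : lin_on S phi -> S u -> S v -> phi (u - v) = phi u - phi v.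
Proof. by move=> pl Su Sv; rewrite addrC -scaleN1r pl// mulN1r addrC. Qed.

Lemma dual_norm_ge S N phi u : seminormed S N -> dual_set S N phi ->
  S u -> N u <= 1 -> `|phi u| <= dual_norm S N phi.
Proof.
move=> [_ _ N0 _] [_ [C phiC]] Su Nu; apply: ub_le_sup; last by exists u.
exists `|C| => _ [w [Sw Nw] <-]; apply: le_trans (phiC w Sw) _.
apply: le_trans (ler_wpM2r (N0 w Sw) (ler_norm C)) _.
by rewrite -[leRHS]mulr1 ler_wpM2l.
Qed.

Lemma dual_norm_bound S N phi u : seminormed S N -> dual_set S N phi ->
  S u -> `|phi u| <= dual_norm S N phi * N u.
Proof.
move=> SN phiD Su; have [S0 _ N0 NZ] := SN; have [pl [C phiC]] := phiD.
(* A vector with [N u = 0] cannot be normalised, but there the constant [C] already gives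
   [phi u = 0]. *)
have := N0 u Su; rewrite le_eqVlt => /predU1P[Nu0|Nu0].
  by rewrite -Nu0 mulr0; have := phiC u Su; rewrite -Nu0 mulr0.
rewrite -ler_pdivrMr// mulrC -[(N u)^-1]ger0_norm ?invr_ge0 ?(ltW Nu0)// -normrM.
rewrite -(lin_onZ _ S0 pl Su); apply: dual_norm_ge => //; first exact: seminormedZ SN Su.
apply: le_trans (NZ _ _ Su) _.
by rewrite ger0_norm ?invr_ge0 ?(ltW Nu0)// mulVf// gt_eqF.
Qed.

Lemma dual_norm_le S N phi (C : R) : seminormed S N -> 0 <= C ->
  (forall u, S u -> `|phi u| <= C * N u) -> dual_norm S N phi <= C.
Proof.
move=> SN C0 phiC; have [S0 _ _ _] := SN; apply: ge_sup.
  by exists `|phi 0|, 0 => //; split; rewrite ?(seminormed0 SN).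
move=> _ [u [Su Nu] <-]; apply: le_trans (phiC u Su) _.
by rewrite -[leRHS]mulr1 ler_wpM2l.
Qed.

Lemma dual_norm_ge0 S N phi : seminormed S N -> dual_set S N phi -> 0 <= dual_norm S N phi.
Proof.
move=> SN phiD; have [S0 _ _ _] := SN; apply: le_trans (normr_ge0 (phi 0)) _.
by apply: dual_norm_ge => //; rewrite (seminormed0 SN).
Qed.

Lemma dual_set_lin S N (a : R) phi psi : seminormed S N ->
  dual_set S N phi -> dual_set S N psi -> dual_set S N (a *: phi + psi).
Proof.
move=> SN phiD psiD; split=> [b u v Su Sv|].
  rewrite !fctE /= phiD.1// psiD.1//= /GRing.scale /=; lra.
exists (`|a| * dual_norm S N phi + dual_norm S N psi) => u Su.
rewrite mulrDl; apply: le_trans (ler_normD _ _) _.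
apply: lerD; last exact: dual_norm_bound.
rewrite -mulrA normrM ler_wpM2l//; exact: dual_norm_bound.
Qed.

Lemma dual_normD S N phi psi : seminormed S N ->
  dual_set S N phi -> dual_set S N psi ->
  dual_norm S N (phi + psi) <= dual_norm S N phi + dual_norm S N psi.
Proof.
move=> SN phiD psiD; apply: dual_norm_le => // [|u Su].
  by rewrite addr_ge0// dual_norm_ge0.
by rewrite mulrDl; apply: le_trans (ler_normD _ _) _; apply: lerD; apply: dual_norm_bound.
Qed.

End SeminormedDual.

Section Bidual.
Context {R : realType} {V : lmodType R}.
Implicit Types (S : set V) (N : V -> R) (phi psi : V -> R).

Lemma seminormed_dual S N : seminormed S N -> seminormed (dual_set S N) (dual_norm S N).
Proof.
move=> SN; split.
- split=> [a u v _ _|]; first by rewrite mulr0 addr0.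
  by exists 0 => u _; rewrite normr0 mul0r.
- by move=> a phi psi; apply: dual_set_lin.
- by move=> phi; apply: dual_norm_ge0.
- move=> a phi phiD; apply: dual_norm_le => // [|u Su].
    by rewrite mulr_ge0// dual_norm_ge0.
  by rewrite -mulrA normrM ler_wpM2l// dual_norm_bound.
Qed.

(** Dual elements are functions on all of [V], with arbitrary values off [S]. The difference of two
    that agree on [S] has dual norm 0, and [Phi] is bounded by that norm. *)
Lemma bidual_ext S N phi psi (Phi : (V -> R) -> R) : seminormed S N ->
  bidual_set S N Phi -> dual_set S N phi -> dual_set S N psi ->
  (forall u, S u -> phi u = psi u) -> Phi phi = Phi psi.
Proof.
move=> SN PhiD phiD psiD eq_phi; have SN' := seminormed_dual SN.
have phipsiD : dual_set S N (phi - psi) by apply: seminormedB SN' _ _.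
apply/eqP; rewrite -subr_eq0 -(lin_onB PhiD.1)// -normr_le0.
apply: le_trans (dual_norm_bound SN' PhiD phipsiD) _.
rewrite mulr_ge0_le0//; first exact: dual_norm_ge0.
by apply: dual_norm_le => // u Su; rewrite mul0r !fctE eq_phi// subrr normr0.
Qed.

End Bidual.

(** * Lipschitz functions and the free space *)

Section LipschitzFree.
Context {R : realType} {M : Type} (d : M -> M -> R) (p0 : M).
Hypothesis dM : is_metric d.

Lemma metric_gt0 x y : x <> y -> 0 < d x y.
Proof.
case: dM => d0 dE _ _ xy; rewrite lt_neqAle d0 andbT eq_sym.
by apply/eqP => /dE.
Qed.

Lemma lip_norm_le (f : M -> R) (C : R) : 0 <= C ->
  (forall x y, `|f x - f y| <= C * d x y) -> lip_norm d f <= C.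
Proof.
move=> C0 fC; rewrite /lip_norm; set A := (X in sup X).
(* If [M] is a single point there are no quotients, and the supremum of the empty set is 0. *)
have [->|/set0P A0] := eqVneq A set0; first by rewrite sup0.
apply: ge_sup => // _ [[x y] /= xy <-].
by rewrite ler_pdivrMr ?metric_gt0.
Qed.

Lemma lip_norm_bound (f : M -> R) x y : Lip0 d p0 f ->
  `|f x - f y| <= lip_norm d f * d x y.
Proof.
case: (dM) => d0 dE _ _ [_ [L fL]].
have [xy|xy] := pselect (x = y).
  by rewrite xy subrr normr0 (_ : d y y = 0) ?mulr0//; apply/dE.
rewrite -ler_pdivrMr ?metric_gt0//; apply: ub_le_sup; last by exists (x, y).
exists L => _ [[u v] /= uv <-].
by rewrite ler_pdivrMr ?metric_gt0.
Qed.

Lemma lip_norm_ge0 (f : M -> R) : 0 <= lip_norm d f.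
Proof.
rewrite /lip_norm; set A := (X in sup X).
(* When the supremum does not exist, [sup] has the default value 0. *)
have [sA|/sup_out ->//] := pselect (has_sup A).
have [[r Ar] _] := sA; apply: le_trans (sup_upper_bound sA Ar).
by case: Ar => -[x y] /= xy <-; rewrite divr_ge0//; case: dM.
Qed.

Lemma seminormed_Lip0 : seminormed (Lip0 d p0) (lip_norm d).
Proof.
split.
- by split=> //; exists 0 => x y; rewrite subrr normr0 mul0r.
- move=> a f g fL gL; split; first by rewrite !fctE /= fL.1 gL.1 addr0 scaler0.
  exists (`|a| * lip_norm d f + lip_norm d g) => x y.
  rewrite !fctE /= opprD addrACA -scalerBr mulrDl.
  apply: le_trans (ler_normD _ _) _; apply: lerD; last exact: lip_norm_bound.
  by rewrite normrM -mulrA ler_wpM2l// lip_norm_bound.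
- by move=> f _; apply: lip_norm_ge0.
- move=> a f fL; apply: lip_norm_le => [|x y].
    by rewrite mulr_ge0// lip_norm_ge0.
  by rewrite !fctE /= -scalerBr normrM -mulrA ler_wpM2l// lip_norm_bound.
Qed.

Notation LD := (dual_set (Lip0 d p0) (lip_norm d)).
Notation NF := (free_norm d p0).
Notation F := (free_space d p0).

Lemma seminormed_LD : seminormed LD NF.
Proof. exact: seminormed_dual seminormed_Lip0. Qed.

Lemma delta_dual p : LD (delta p).
Proof.
split=> // ; exists (d p p0) => f fL.
by have := lip_norm_bound p p0 fL; rewrite fL.1 subr0 mulrC.
Qed.

Lemma free_space_lin (a : R) z1 z2 : F z1 -> F z2 -> F (a *: z1 + z2).
Proof.
move=> [z1D z1s] [z2D z2s]; have SN := seminormed_LD.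
have [_ SD _ NZ] := SN.
split=> [|e e0]; first exact: SD.
have spanD (s : seq (R * ((M -> R) -> R))) :
    (forall c, List.In c s -> [set delta p | p in setT] c.2) ->
    LD (\sum_(c <- s) c.1 *: c.2).
  elim: s => [|c s IH] cs; first by rewrite big_nil; case: SN.
  rewrite big_cons; apply: SD; last by apply: IH => c' c's; apply: cs; right.
  by have [p _ <-] := cs c (or_introl erefl); apply: delta_dual.
(* The accuracy for [z1] is divided by [|a| + 1] so that scaling by [a] keeps the error below
   [e / 2], also when [a = 0]. *)
have e10 : 0 < e / 2 / (`|a| + 1) by rewrite !divr_gt0// ltr_wpDl.
have e20 : 0 < e / 2 by rewrite divr_gt0.
have [s1 [s1D s1e]] := z1s _ e10; have [s2 [s2D s2e]] := z2s _ e20.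
pose as1 := [seq (a * c.1, c.2) | c <- s1].
exists (as1 ++ s2); split.
  move=> c /(@List.in_app_or _ as1 s2)[|]; last exact: s2D.
  by move=> /(@List.in_map_iff _ _ _ s1)[c' [<- /s1D]].
rewrite big_cat big_map /=.
have -> : \sum_(c <- s1) (a * c.1) *: c.2 = a *: \sum_(c <- s1) c.1 *: c.2.
  by rewrite scaler_sumr; apply: eq_bigr => c _; rewrite scalerA.
rewrite opprD addrACA -scalerBr.
have D1 : LD (z1 - \sum_(c <- s1) c.1 *: c.2).
  by apply: (seminormedB SN) => //; apply: spanD.
have D2 : LD (z2 - \sum_(c <- s2) c.1 *: c.2).
  by apply: (seminormedB SN) => //; apply: spanD.
apply: le_lt_trans (dual_normD seminormed_Lip0 (seminormedZ a SN D1) D2) _.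
apply: le_lt_trans (lerD (NZ a _ D1) (lexx _)) _.
have : `|a| * NF (z1 - \sum_(c <- s1) c.1 *: c.2) <= `|a| * (e / 2 / (`|a| + 1)).
  by rewrite ler_wpM2l// ltW.
have : `|a| * (e / 2 / (`|a| + 1)) <= e / 2.
  rewrite mulrCA ler_piMr ?(ltW e20)// ler_pdivrMr ?mul1r ?lerDl// ltr_wpDl//.
rewrite /free_norm in s2e *; lra.
Qed.

Lemma delta_free p : F (delta p).
Proof.
split=> [|e e0]; first exact: delta_dual.
exists [:: (1, delta p)]; split=> [c [<-|//]|]; first by exists p.
by rewrite big_seq1 scale1r subrr -/(free_norm d p0 0) (seminormed0 seminormed_LD).
Qed.

Lemma seminormed_free : seminormed F NF.
Proof.
have [D0 DD N0 NZ] := seminormed_LD; split.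
- split=> // e e0; exists [::]; split=> //.
  by rewrite big_nil subr0 -/(free_norm d p0 0) (seminormed0 seminormed_LD).
- exact: free_space_lin.
- by move=> z [zD _]; apply: N0.
- by move=> a z [zD _]; apply: NZ.
Qed.

Lemma free_norm_deltaB p q : NF (delta p - delta q) <= d p q.
Proof.
apply: dual_norm_le => [||f fL]; [exact: seminormed_Lip0|by case: dM|].
by rewrite mulrC; apply: lip_norm_bound.
Qed.

(** By linearity [phi] vanishes on finite combinations of evaluations; these approximate [z], and
    the bound by [C] makes the error in [phi] arbitrarily small. *)
Lemma free_space_density (phi : ((M -> R) -> R) -> R) (C : R) z :
  lin_on F phi -> (forall w, F w -> `|phi w| <= C * NF w) ->
  (forall p, phi (delta p) = 0) -> F z -> phi z = 0.
Proof.
move=> phil phiC phi0 Fz; have SF := seminormed_free.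
have [F0 FD N0 _] := SF.
have span0 (s : seq (R * ((M -> R) -> R))) :
    (forall c, List.In c s -> [set delta p | p in setT] c.2) ->
    F (\sum_(c <- s) c.1 *: c.2) /\ phi (\sum_(c <- s) c.1 *: c.2) = 0.
  elim: s => [|c s IH] cs; first by rewrite big_nil; split=> //; apply: lin_on0 phil.
  have [p _ pc] := cs c (or_introl erefl).
  have [|Fs phis] := IH; first by move=> c' c's; apply: cs; right.
  have Fc : F c.2 by rewrite -pc; apply: delta_free.
  rewrite big_cons; split; first exact: FD.
  by rewrite phil// phis -pc phi0 mulr0 addr0.
apply/eqP; rewrite -normr_le0; apply/ler_addgt0Pr => e e0; rewrite add0r.
have e10 : 0 < e / (`|C| + 1) by rewrite divr_gt0// ltr_wpDl.
have [s [/span0[Fs phis] se]] := Fz.2 _ e10.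
have -> : phi z = phi (z - \sum_(c <- s) c.1 *: c.2).
  by rewrite (lin_onB phil)// phis subr0.
have Fd : F (z - \sum_(c <- s) c.1 *: c.2) by apply: (seminormedB SF).
apply: le_trans (phiC _ Fd) _.
apply: le_trans (ler_wpM2r (N0 _ Fd) (ler_norm C)) _.
apply: le_trans (ler_wpM2l (normr_ge0 C) (ltW se)) _.
rewrite mulrCA ler_piMr ?(ltW e0)// ler_pdivrMr ?mul1r ?lerDl// ltr_wpDl//.
Qed.

End LipschitzFree.

(** * The projective tensor product and its dual *)

Section Tensor.
Context {R : realType} {V : lmodType R} {X : normedModType R}.
Context {S : set V} {N : V -> R}.
Hypothesis SN : seminormed S N.
Notation AT := (alg_tensor (X := X) S).
Notation PN := (proj_norm (X := X) S N).

Lemma tens_cat (s1 s2 : seq (V * X)) : tens S (s1 ++ s2) = tens S s1 + tens S s2.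
Proof.
apply/funext => A; rewrite !fctE /tens; case: ifP => _; last by rewrite addr0.
by rewrite big_cat.
Qed.

Lemma tens_scale (a : R) (s : seq (V * X)) : (forall c, List.In c s -> S c.1) ->
  tens S [seq (a *: c.1, c.2) | c <- s] = a *: tens S s.
Proof.
move=> sS; apply/funext => A; rewrite fctE /tens.
case: asboolP => [[Al _]|_]; last by rewrite scaler0.
rewrite big_map; elim: s sS => [|c s IH] sS; first by rewrite !big_nil scaler0.
rewrite !big_cons IH => [|c' c's]; last by apply: sS; right.
have [S0 _ _ _] := SN.
rewrite scalerDr; congr (_ + _) => /=.
have A0 : lin_on S (A^~ c.2) by move=> b u v; apply: Al.
exact: (lin_onZ a S0 A0 (sS c (or_introl erefl))).
Qed.

Lemma alg_tensor1 z x : S z -> AT (tens S [:: (z, x)]).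
Proof. by move=> Sz; exists [:: (z, x)]; split=> // c [<-|[]]. Qed.

Lemma proj_norm_le (s : seq (V * X)) : (forall c, List.In c s -> S c.1) ->
  PN (tens S s) <= \sum_(c <- s) N c.1 * `|c.2|.
Proof.
move=> sS; have [_ _ N0 _] := SN; apply: (@inf_le_mem _ _ 0); last by exists s.
move=> _ [s' [s'S [_ ->]]]; elim: s' s'S => [|c s' IH] cS; first by rewrite big_nil.
rewrite big_cons addr_ge0//; last by apply: IH => c' c's; apply: cS; right.
by rewrite mulr_ge0// N0//; apply: cS; left.
Qed.

Lemma le_proj_norm (u : (V -> X -> R) -> R) (a C : R) : AT u -> 0 <= C ->
  (forall s : seq (V * X), (forall c, List.In c s -> S c.1) -> u = tens S s ->
     a <= C * \sum_(c <- s) N c.1 * `|c.2|) ->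
  a <= C * PN u.
Proof.
move=> [s [sS us]] C0 aC; apply: inf_scale_ge => //.
  by exists (\sum_(c <- s) N c.1 * `|c.2|), s.
by move=> _ [s' [s'S [us' ->]]]; apply: aC.
Qed.

Lemma seminormed_alg_tensor : seminormed AT PN.
Proof.
have [S0 SD N0 NZ] := SN; have scaleS (a : R) (s : seq (V * X)) :
    (forall c, List.In c s -> S c.1) ->
    forall c, List.In c [seq (a *: c.1, c.2) | c <- s] -> S c.1.
  move=> sS c /(@List.in_map_iff _ _ _ s)[c' [<- /sS]].
  exact: seminormedZ SN.
split.
- by exists [::]; split=> //; apply/funext => A; rewrite /tens big_nil; case: ifP.
- move=> a _ _ [s1 [s1S ->]] [s2 [s2S ->]].
  exists ([seq (a *: c.1, c.2) | c <- s1] ++ s2); split; last by rewrite tens_cat tens_scale.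
  move=> c /(@List.in_app_or _ [seq (a *: c.1, c.2) | c <- s1] s2)[|]; last exact: s2S.
  exact: scaleS.
- move=> u uAT; rewrite -[PN u]mul1r; apply: le_proj_norm => // s sS _.
  rewrite mul1r; elim: s sS => [|c s' IH] cS; first by rewrite big_nil.
  rewrite big_cons addr_ge0//; last by apply: IH => c' c's; apply: cS; right.
  by rewrite mulr_ge0// N0//; apply: cS; left.
- move=> a u uAT; apply: le_proj_norm => // s sS us.
  rewrite us -tens_scale//; apply: le_trans (proj_norm_le (scaleS a s sS)) _.
  rewrite big_map mulr_sumr {us}; elim: s sS => [|c s IH] sS; first by rewrite !big_nil.
  rewrite !big_cons lerD//; last by apply: IH => c' c's; apply: sS; right.
  by rewrite mulrA ler_wpM2r// NZ//; apply: sS; left.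
Qed.

Lemma tens_lin (a : R) z1 z2 x : S z1 -> S z2 ->
  tens S [:: (a *: z1 + z2, x)] = a *: tens S [:: (z1, x)] + tens S [:: (z2, x)] :> ((V -> X -> R) -> R).
Proof.
move=> Sz1 Sz2; apply/funext => A; rewrite !fctE /tens /= !big_seq1 /=.
by case: asboolP => [[-> //]|_]; rewrite scaler0 addr0.
Qed.

Lemma tens_linr (a : R) z x1 x2 : S z ->
  tens S [:: (z, a *: x1 + x2)] = a *: tens S [:: (z, x1)] + tens S [:: (z, x2)] :> ((V -> X -> R) -> R).
Proof.
move=> Sz; apply/funext => A; rewrite !fctE /tens /= !big_seq1 /=.
by case: asboolP => [[_ -> //]|_]; rewrite scaler0 addr0.
Qed.

Lemma dual_tens (phi : ((V -> X -> R) -> R) -> R) (s : seq (V * X)) :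
  lin_on AT phi -> (forall c, List.In c s -> S c.1) ->
  phi (tens S s) = \sum_(c <- s) phi (tens S [:: c]).
Proof.
move=> phil; have [T0 _ _ _] := seminormed_alg_tensor.
elim: s => [|c s IH] sS.
  rewrite big_nil (_ : tens S [::] = 0); first exact: lin_on0 phil.
  by apply/funext => A; rewrite /tens big_nil; case: ifP.
have sS' c' : List.In c' s -> S c'.1 by move=> c's; apply: sS; right.
rewrite big_cons -IH// -cat1s tens_cat -[tens S [:: c]]scale1r phil ?mul1r ?scale1r//.
  by case: c sS => z x /(_ (z, x) (or_introl erefl)); apply: alg_tensor1.
by exists s.
Qed.

Lemma proj_norm1 z x : S z -> PN (tens S [:: (z, x)]) <= N z * `|x|.
Proof.
move=> Sz; have -> : N z * `|x| = \sum_(c <- [:: (z, x)]) N c.1 * `|c.2|.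
  by rewrite big_seq1.
by apply: proj_norm_le => c [<-|[]].
Qed.

End Tensor.

(** * Lipschitz maps into the dual of [X] as functionals on the tensor product *)

Section LipschitzForms.
Context {R : realType} {M : Type} (d : M -> M -> R) (p0 : M) {X : normedModType R}.
Hypothesis dM : is_metric d.
Notation F := (free_space d p0).
Notation NF := (free_norm d p0).
Notation AT := (alg_tensor (X := X) F).
Notation PN := (proj_norm (X := X) F NF).

(* Lipschitz maps from [M] to the dual of [X] vanishing at [p0], uncurried:
   these represent the dual of the projective tensor product. *)
Definition lip_form (C : R) (g : M -> X -> R) :=
  [/\ forall p (a : R) x y, g p (a *: x + y) = a * g p x + g p y,
      forall x, g p0 x = 0 &
      forall p q x, `|g p x - g q x| <= C * d p q * `|x|].

(** A tensor is itself a functional on bilinear forms, so pairing it with [g] is evaluation at the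
    bilinear form that [g] induces on the free space and [X]. *)
Definition form_functional (g : M -> X -> R) : ((((M -> R) -> R) -> X -> R) -> R) -> R :=
  fun u => u (fun z x => z (g^~ x)).

Lemma lip_form_Lip0 C g x : lip_form C g -> Lip0 d p0 (g^~ x).
Proof.
move=> [_ g0 gC]; split=> //; exists (C * `|x|) => p q.
by rewrite mulrAC.
Qed.

Lemma lip_form_lip_norm C g x : 0 <= C -> lip_form C g -> lip_norm d (g^~ x) <= C * `|x|.
Proof.
move=> C0 [_ _ gC]; apply: (lip_norm_le dM) => [|p q]; first by rewrite mulr_ge0.
by rewrite mulrAC.
Qed.

Lemma lip_form_bilin C g : lip_form C g -> bilin_on F (fun z (x : X) => z (g^~ x)).
Proof.
move=> gC; split=> // a z x1 x2 [zD _].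
have -> : g^~ (a *: x1 + x2) = a *: (g^~ x1) + g^~ x2.
  by apply/funext => p; case: gC => gl _ _; rewrite !fctE gl.
by apply: zD.1; apply: lip_form_Lip0 gC.
Qed.

Lemma form_functional_tens C g (s : seq (((M -> R) -> R) * X)) : lip_form C g ->
  form_functional g (tens F s) = \sum_(c <- s) c.1 (g^~ c.2).
Proof.
move=> gC; rewrite /form_functional /tens; case: asboolP => // -[].
exact: lip_form_bilin gC.
Qed.

(** For every representation of [u], each term [z (g^~ x)] is at most the norm of [z] times the
    Lipschitz norm of [g^~ x], which is at most [C * |x|]. *)
Lemma form_functional_bound C g u : 0 <= C -> lip_form C g -> AT u ->
  `|form_functional g u| <= C * PN u.
Proof.
move=> C0 gC uT; refine (le_proj_norm uT C0 _) => s sF ->.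
rewrite (form_functional_tens s gC).
elim: s sF => [|c s IH] sF; first by rewrite !big_nil normr0 mulr0.
rewrite !big_cons mulrDr; apply: le_trans (ler_normD _ _) _; apply: lerD; last first.
  by apply: IH => c' c's; apply: sF; right.
have [cD _] := sF c (or_introl erefl).
apply: le_trans (dual_norm_bound (seminormed_Lip0 p0 dM) cD (lip_form_Lip0 c.2 gC)) _.
rewrite mulrCA ler_wpM2l//; last exact: lip_form_lip_norm.
exact: dual_norm_ge0 (seminormed_Lip0 p0 dM) cD.
Qed.

Lemma form_functional_dual C g : 0 <= C -> lip_form C g ->
  dual_set AT PN (form_functional g).
Proof. by move=> C0 gC; split=> //; exists C => u; apply: form_functional_bound. Qed.

Lemma seminormed_proj : seminormed AT PN.
Proof. exact: seminormed_alg_tensor (seminormed_free p0 dM). Qed.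

Lemma form_functional_norm C g : 0 <= C -> lip_form C g ->
  dual_norm AT PN (form_functional g) <= C.
Proof.
move=> C0 gC; apply: dual_norm_le => // [|u uT]; first exact: seminormed_proj.
exact: form_functional_bound.
Qed.

Lemma lip_form_lin C1 C2 (a : R) g1 g2 : lip_form C1 g1 -> lip_form C2 g2 ->
  lip_form (`|a| * C1 + C2) (a *: g1 + g2).
Proof.
move=> [l1 z1 b1] [l2 z2 b2]; split.
- by move=> p b x y; rewrite !fctE l1 l2 /GRing.scale /=; lra.
- by move=> x; rewrite !fctE z1 z2 addr0 scaler0.
- move=> p q x; rewrite !fctE opprD addrACA -scalerBr !mulrDl.
  apply: le_trans (ler_normD _ _) _; apply: lerD; last exact: b2.
  by rewrite normrM -!mulrA ler_wpM2l// mulrA.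
Qed.

Lemma form_functional_lin C1 C2 (a : R) g1 g2 u : lip_form C1 g1 -> lip_form C2 g2 -> AT u ->
  form_functional (a *: g1 + g2) u = a * form_functional g1 u + form_functional g2 u.
Proof.
move=> g1C g2C [s [sF ->]].
rewrite (form_functional_tens s (lip_form_lin a g1C g2C)).
rewrite (form_functional_tens s g1C) (form_functional_tens s g2C).
elim: s sF => [|c s IH] sF; first by rewrite !big_nil mulr0 addr0.
rewrite !big_cons IH => [|c' c's]; last by apply: sF; right.
have [cD _] := sF c (or_introl erefl).
have -> : (a *: g1 + g2)^~ c.2 = a *: (g1^~ c.2) + g2^~ c.2 by [].
rewrite cD.1; [|exact: lip_form_Lip0 g1C|exact: lip_form_Lip0 g2C].
by rewrite mulrDr addrACA.
Qed.

(** The map is [g p x = phi (delta p (x) x)], with the Lipschitz constant coming from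
    [free_norm_deltaB]. Both functionals agree on evaluations tensored with [x], hence by density on
    all elementary tensors. *)
Lemma dual_form_functional phi : dual_set AT PN phi ->
  exists2 g, lip_form (dual_norm AT PN phi) g &
    forall u, AT u -> phi u = form_functional g u.
Proof.
move=> phiD; have [phil _] := phiD; have SF := seminormed_free p0 dM.
have ST := seminormed_proj; have [F0 FD N0 _] := SF.
pose C := dual_norm AT PN phi; have C0 : 0 <= C by apply: dual_norm_ge0.
pose A z x := phi (tens F [:: (z, x)]).
have Al x : lin_on F (A^~ x).
  move=> a z1 z2 Fz1 Fz2; rewrite /A tens_lin// phil//; exact: alg_tensor1.
have Ar a z x1 x2 : F z -> A z (a *: x1 + x2) = a * A z x1 + A z x2.
  by move=> Fz; rewrite /A tens_linr// phil//; apply: alg_tensor1.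
have AC z x : F z -> `|A z x| <= C * (NF z * `|x|).
  move=> Fz; apply: le_trans (dual_norm_bound ST phiD (alg_tensor1 _ Fz)) _.
  by rewrite ler_wpM2l// proj_norm1.
have Fd p : F (delta p) by apply: delta_free.
pose g p x := A (delta p) x.
have gC : lip_form C g.
  split=> [p a x y|x|p q x]; first exact: Ar.
    (* [delta p0] is not the zero function on [M -> R], but its free norm is 0 because members of
       [Lip0] vanish at [p0]. *)
    apply/eqP; rewrite -normr_le0; apply: le_trans (AC _ _ (Fd p0)) _.
    rewrite mulr_ge0_le0// mulr_le0_ge0//.
    apply: dual_norm_le => // [|f [f0 _]]; first exact: seminormed_Lip0.
    by rewrite /delta f0 normr0 mul0r.
  rewrite /g -(lin_onB (Al x))// -mulrA.
  apply: le_trans (AC _ _ (seminormedB SF (Fd p) (Fd q))) _.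
  by rewrite ler_wpM2l// ler_wpM2r// free_norm_deltaB.
exists g => // _ [s [sF ->]].
rewrite (form_functional_tens s gC) (dual_tens SF)//.
have Ag z x : F z -> A z x = z (g^~ x).
  move=> Fz; apply/eqP; rewrite -subr_eq0; apply/eqP.
  have gL : Lip0 d p0 (g^~ x) by apply: lip_form_Lip0 gC.
  apply: (@free_space_density _ _ _ p0 dM (fun w => A w x - w (g^~ x))
    (C * `|x| + lip_norm d (g^~ x))) => //.
  - move=> a z1 z2 Fz1 Fz2 /=; rewrite (Al x)// !fctE /GRing.scale /=; lra.
  - move=> w Fw; apply: le_trans (ler_normB _ _) _; rewrite mulrDl lerD//.
      by rewrite mulrAC -mulrA AC.
    by rewrite mulrC; apply: dual_norm_bound => //; [exact: seminormed_Lip0|case: Fw].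
  - by move=> p; rewrite /g subrr.
elim: s sF => [|c s IH] sF; first by rewrite !big_nil.
rewrite !big_cons IH => [|c' c's]; last by apply: sF; right.
by congr (_ + _); rewrite -Ag; [case: (c)|apply: sF; left].
Qed.

End LipschitzForms.

(** * Perturbing Lipschitz maps near cluster points *)

Lemma ln_sub_le (R : realType) (a b : R) : 0 < b -> b <= a -> ln a - ln b <= (a - b) / b.
Proof.
move=> b0 ba; have a0 : 0 < a by apply: lt_le_trans ba.
rewrite -ln_div ?posrE//.
have -> : a / b = 1 + (a - b) / b by field; rewrite gt_eqF.
apply: le_ln1Dx; apply: (@lt_le_trans _ _ 0); first by rewrite ltrN10.
by rewrite divr_ge0 ?subr_ge0// ltW.
Qed.

(* A cutoff whose slope at [t] is at most [e / t]: possible since [1 / t] is not integrable at [0]. *)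
Lemma log_cutoff (R : realType) (r e : R) : 0 < r -> 0 < e ->
  exists delta (phi : R -> R),
    [/\ 0 < delta < r, forall t, t <= delta -> phi t = 0, forall t, r <= t -> phi t = 1,
        forall t, 0 <= phi t <= 1 &
        forall s t, 0 <= s -> s <= t -> `|phi t - phi s| * s <= e * (t - s)].
Proof.
(* The cutoff is [e * ln (t / D)] with [t] clamped to [[D, r]]; this [D] makes
   [e * (ln r - ln D) = 1], so it climbs exactly from 0 to 1. *)
move=> r0 e0; pose D := r * expR (- e^-1).
have D0 : 0 < D by rewrite mulr_gt0// expR_gt0.
have Dr : D < r.
  by rewrite -[ltRHS]mulr1 ltr_pM2l// expR_lt1 oppr_lt0 invr_gt0.
have lnD : ln D = ln r - e^-1 by rewrite lnM ?posrE ?expR_gt0// expRK.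
pose c t := Num.max D (Num.min t r).
have cD t : D <= c t by rewrite le_max lexx.
have cr t : c t <= r by rewrite ge_max ltW//= ge_min lexx orbT.
have c0 t : 0 < c t by apply: lt_le_trans (cD t).
exists D, (fun t => e * (ln (c t) - ln D)); split=> [|t tD|t rt|t|s t s0 st].
- by rewrite D0.
- rewrite (_ : c t = D) ?subrr ?mulr0//.
  by apply/max_idPl; rewrite ge_min tD.
- rewrite (_ : c t = r) ?lnD; last by rewrite /c min_r// max_r// (ltW Dr).
  by field; rewrite gt_eqF.
- have e1 : e * e^-1 = 1 by rewrite mulfV// gt_eqF.
  apply/andP; split; first by rewrite mulr_ge0 ?(ltW e0)// subr_ge0 ler_ln ?posrE.
  rewrite -e1 ler_pM2l// lnD; have : ln (c t) <= ln r by rewrite ler_ln ?posrE.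
  lra.
- have cst : c s <= c t.
    rewrite /c ge_max le_max lexx /= le_max; apply/orP; right.
    by rewrite le_min ge_min st /= ge_min lexx orbT.
  have lst : 0 <= ln (c t) - ln (c s) by rewrite subr_ge0 ler_ln ?posrE.
  have -> : e * (ln (c t) - ln D) - e * (ln (c s) - ln D) = e * (ln (c t) - ln (c s)) by ring.
  rewrite ger0_norm ?mulr_ge0 ?(ltW e0)// -mulrA ler_pM2l//.
  (* Beyond [r] the cutoff is constant. Otherwise [s <= c s], which absorbs the factor [1 / c s] in
     the slope of the logarithm. *)
  have [rs|sr] := leP r s.
    rewrite (_ : c t = c s) ?subrr ?mul0r ?subr_ge0//.
    by rewrite /c !min_r//; apply: le_trans st.
  have sc : s <= c s by rewrite /c min_l ?(ltW sr)// le_max lexx orbT.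
  apply: le_trans (ler_wpM2r s0 (ln_sub_le (c0 s) cst)) _.
  rewrite mulrAC ler_pdivrMr//.
  have cts : c t - c s <= t - s.
    rewrite /c; case: (leP t r) => ?; case: (leP s r) => ?;
      case: (leP D t) => ?; case: (leP D s) => ?; case: (leP D r) => ?; lra.
  apply: le_trans (ler_wpM2l _ sc) _; first by rewrite subr_ge0.
  by rewrite ler_wpM2r// ltW.
Qed.

Section Perturbation.
Context {R : realType} {M : Type} (d : M -> M -> R) (p0 : M) {X : normedModType R}.
Hypothesis dM : is_metric d.

(* Flatten [f] near [p] by the logarithmic cutoff, which costs a factor [1 + e],
   then add on the flat part a small bump of slope one. *)
Lemma perturbation (r e : R) (xs : X -> R) : 0 < r -> 0 < e ->
  (forall (a : R) x y, xs (a *: x + y) = a * xs x + xs y) ->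
  (forall x, `|xs x| <= `|x|) ->
  exists2 b : R, 0 < b & forall p f, r <= d p0 p -> lip_form d p0 1 f ->
    exists h, [/\ lip_form d p0 (1 + e) h,
      forall y, r <= d y p -> h y = f y &
      forall v x, d v p < b -> h p x - h v x = d v p * xs x].
Proof.
move=> r0 e0 xsl xs1; have [d0 dE dC dT] := dM.
have e20 : 0 < e / 2 by rewrite divr_gt0.
have [D [phi [/andP[D0 Dr] phi0 phi1 phi01 phiL]]] := log_cutoff r0 e20.
(* The height [b] of the bump solves [b = (e / 2) * (D - b)]: between the support of the bump and
   the outside of the [D]-ball its slope is at most [e / 2]. *)
pose b := (e / 2) * D / (1 + e / 2).
have b0 : 0 < b by rewrite divr_gt0 ?mulr_gt0// addr_gt0.
have bE : b * (1 + e / 2) = (e / 2) * D.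
  by rewrite /b; field; rewrite gt_eqF// addr_gt0.
have bD : b < D by nra.
(* [b] is fixed before [p] and [f], so one point [v] close to [p] will serve finitely many maps [f]
   at once. *)
exists b => // p f rp [fl f0 fL].
pose B t : R := Num.max 0 (b - t).
have dpp : d p p = 0 by apply/dE.
pose h y x := f p x + phi (d y p) * (f y x - f p x) + B (d y p) * xs x.
have B0 t : b <= t -> B t = 0 by move=> bt; rewrite /B max_l// subr_le0.
have hf y : r <= d y p -> h y = f y.
  move=> ry; apply/funext => x; rewrite /h phi1// B0; first by ring.
  by apply: le_trans ry; apply/ltW/(lt_trans bD).
have near y x : d y p <= D -> h y x = f p x + B (d y p) * xs x.
  by move=> yD; rewrite /h phi0// mul0r addr0.
exists h; split=> //; last first.
  move=> v x vb; have vD : d v p <= D by apply/ltW/(lt_trans vb).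
  rewrite !near ?dpp ?(ltW D0)// /B subr0 !max_r; [ring| |exact: ltW].
  by rewrite subr_ge0 ltW.
split.
- by move=> y a x x'; rewrite /h !fl xsl; ring.
- by move=> x; rewrite hf.
have BL s t : s <= t -> `|B s - B t| <= t - s.
  by move=> st; rewrite /B ler_norml; case: (leP 0 (b - s)) => ?; case: (leP 0 (b - t)) => ?; apply/andP; split; lra.
have main y w x : d y p <= d w p -> `|h y x - h w x| <= (1 + e) * d y w * `|x|.
  move=> yw; have dyw : d w p - d y p <= d y w 
    by have := dT w y p; rewrite (dC w y); lra.
  have x1 := xs1 x.
  (* If the farther point [w] lies in the flat ball, so does [y], and only the bump, of slope one,
     varies. *)
  have [wD|Dw] := leP (d w p) D.
    rewrite !near//; last exact: le_trans wD.
    rewrite (_ : _ - _ = (B (d y p) - B (d w p)) * xs x); last by ring.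
    rewrite normrM ler_pM//; apply: le_trans (BL _ _ yw) _.
    by apply: le_trans dyw _; rewrite ler_peMl// ; lra.
  have Bw : B (d w p) = 0 by apply: B0; apply/ltW/(lt_trans bD).
  (* The variation of the cutoff multiplies [f y x - f p x], of size at most [d y p * |x|]. Since
     [d y p] is the smaller distance, this product is what [phiL] controls. *)
  have -> : h y x - h w x = phi (d w p) * (f y x - f w x)
      - (phi (d w p) - phi (d y p)) * (f y x - f p x) + B (d y p) * xs x.
    by rewrite /h Bw; ring.
  have t1 : `|phi (d w p) * (f y x - f w x)| <= d y w * `|x|.
    have /andP[ph0 ph1] := phi01 (d w p).
    rewrite normrM ger0_norm// -[leRHS]mul1r ler_pM//.
    by have := fL y w x; rewrite mul1r.
  have t2 : `|(phi (d w p) - phi (d y p)) * (f y x - f p x)| <= e / 2 * d y w * `|x|.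
    rewrite normrM; have := fL y p x; rewrite mul1r => fyp.
    apply: le_trans (ler_wpM2l (normr_ge0 _) fyp) _.
    rewrite mulrA ler_wpM2r//; apply: le_trans (phiL _ _ (d0 _ _) yw) _.
    by rewrite ler_wpM2l// ltW.
  have t3 : `|B (d y p) * xs x| <= e / 2 * d y w * `|x|.
    rewrite normrM ler_pM//; have [by_|yb] := leP b (d y p).
      by rewrite B0// normr0 mulr_ge0// ltW.
    have yb' : 0 <= b - d y p by rewrite subr_ge0 ltW.
    rewrite /B max_r// ger0_norm//.
    have := d0 y p; nra.
  apply: le_trans (ler_normD _ _) _; apply: le_trans (lerD (ler_normB _ _) (lexx _)) _.
  have -> : (1 + e) * d y w * `|x| = d y w * `|x| + e / 2 * d y w * `|x| + e / 2 * d y w * `|x|.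
    by field.
  by rewrite !lerD.
move=> y w x; have [yw|wy] := leP (d y p) (d w p); first exact: main.
by rewrite distrC dC; apply/main/ltW.
Qed.

End Perturbation.

(** * Sums of Lipschitz maps with disjoint supports *)

Section DisjointSupports.
Context {R : realType} {M : Type} (d : M -> M -> R) (p0 : M) {X : normedModType R}.
Hypothesis dM : is_metric d.

Lemma sum_unique_le1 n (P : 'I_n -> Prop) : (forall i j, P i -> P j -> i = j) ->
  \sum_(i < n) (`[< P i >])%:R <= 1 :> R.
Proof.
move=> Pu; have [[i Pi]|nP] := pselect (exists i, P i).
  rewrite (bigD1 i)//= big1 ?addr0; first by rewrite asboolT.
  move=> j ji; rewrite asboolF// => Pj.
  by move: ji; rewrite (Pu _ _ Pi Pj) eqxx.
rewrite big1// => i _; rewrite asboolF// => Pi.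
by apply: nP; exists i.
Qed.

Lemma sum_scaleE n (s : 'I_n -> R) (g : 'I_n -> M -> X -> R) p x :
  (\sum_(k < n) s k *: g k) p x = \sum_(k < n) s k * g k p x.
Proof.
elim/big_ind2: _ => // h1 y1 h2 y2 h1E h2E.
by rewrite -h1E -h2E.
Qed.

(** At most one summand is non-zero at [p] and at most one at [q], so at most two contribute to an
    increment, whatever [n] is; hence the factor 2. *)
Lemma lip_form_sum_disjoint n (C : R) (s : 'I_n -> R) (g : 'I_n -> M -> X -> R)
    (U : 'I_n -> M -> Prop) : 0 <= C ->
  (forall k, `|s k| <= 1) -> (forall k, lip_form d p0 C (g k)) ->
  (forall k y, ~ U k y -> g k y = 0) ->
  (forall j k y, U j y -> U k y -> j = k) ->
  lip_form d p0 (2 * C) (\sum_(k < n) s k *: g k).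
Proof.
move=> C0 s1 gC gU Uu; split.
- move=> p a x y; rewrite !sum_scaleE mulr_sumr -big_split /=.
  by apply: eq_bigr => k _; case: (gC k) => -> _ _; ring.
- by move=> x; rewrite sum_scaleE big1// => k _; case: (gC k) => _ -> _; rewrite mulr0.
- move=> p q x; rewrite !sum_scaleE -sumrB.
  pose D := C * d p q * `|x|.
  have D0 : 0 <= D by rewrite !mulr_ge0//; case: dM.
  have term k : `|s k * g k p x - s k * g k q x| <=
      D * (`[< U k p >])%:R + D * (`[< U k q >])%:R.
    rewrite -mulrBr normrM; case: (gC k) => _ _ /(_ p q x) gb.
    have sgD : `|s k| * `|g k p x - g k q x| <= D.
      by rewrite -[D]mul1r ler_pM.
    case: asboolP => [_|nUp]; first by rewrite mulr1; apply: le_trans sgD _; rewrite lerDl mulr_ge0.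
    case: asboolP => [_|nUq]; first by rewrite mulr1 mulr0 add0r.
    by rewrite !gU// subrr normr0 !mulr0 addr0.
  apply: le_trans (ler_norm_sum _ _ _) _.
  apply: le_trans (ler_sum _ (fun k _ => term k)) _.
  rewrite big_split /= -!mulr_sumr.
  have u1 z : \sum_(k < n) (`[< U k z >])%:R <= 1 :> R.
    by apply: sum_unique_le1 => i j; apply: Uu.
  have -> : 2 * C * d p q * `|x| = D * 1 + D * 1 by rewrite /D; ring.
  by rewrite lerD// ler_wpM2l.
Qed.

(* Sums of the [g k] with signs stay bounded, so no bounded functional can be
   large on many of them. *)
Lemma sum_disjoint_le n (C : R) (T : (M -> X -> R) -> R) (g : 'I_n -> M -> X -> R)
    (U : 'I_n -> M -> Prop) : 0 <= C ->
  (forall C1 C2 (a : R) g1 g2, 0 <= C1 -> 0 <= C2 -> lip_form d p0 C1 g1 -> lip_form d p0 C2 g2 ->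
     T (a *: g1 + g2) = a * T g1 + T g2) ->
  (forall C1 g1, 0 <= C1 -> lip_form d p0 C1 g1 -> `|T g1| <= C1) ->
  (forall k, lip_form d p0 C (g k)) ->
  (forall k y, ~ U k y -> g k y = 0) ->
  (forall j k y, U j y -> U k y -> j = k) ->
  \sum_(k < n) `|T (g k)| <= 2 * C.
Proof.
move=> C0 Tl Tb gC gU Uu; pose s k := Num.sg (T (g k)).
have s1 k : `|s k| <= 1 by rewrite normr_sg lern1 leq_b1.
have lip0 : lip_form d p0 0 (0 : M -> X -> R).
  by split=> [p a x y|//|p q x]; rewrite ?mulr0 ?addr0// subrr normr0 !mul0r.
have T0 : T 0 = 0.
  by apply/eqP; rewrite -normr_le0; apply: Tb.
(* The induction carries some Lipschitz constant, growing with the sum, just to expand [T] linearly;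
   the uniform constant [2 * C] comes from disjointness afterwards. *)
have TS : T (\sum_(k < n) s k *: g k) = \sum_(k < n) s k * T (g k) /\
    exists2 C', 0 <= C' & lip_form d p0 C' (\sum_(k < n) s k *: g k).
  elim: (index_enum _) => [|k r [IH [C' C'0 IHC]]].
    by rewrite !big_nil; split=> //; exists 0.
  rewrite !big_cons; split; first by rewrite (Tl _ _ _ _ _ C0 C'0 (gC k) IHC) IH.
  exists (`|s k| * C + C'); first by rewrite addr_ge0// mulr_ge0.
  exact: lip_form_lin.
have -> : \sum_(k < n) `|T (g k)| = T (\sum_(k < n) s k *: g k).
  by rewrite TS.1; apply: eq_bigr => k _; rewrite /s normrEsg.
apply: le_trans (ler_norm _) _; apply: Tb; first by rewrite mulr_ge0.
exact: (lip_form_sum_disjoint C0 s1 gC gU Uu).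
Qed.

End DisjointSupports.

(** * Selection of separated cluster points *)

Lemma fin_lower_bound (R : realType) (I : finType) (F : I -> R) : (forall i, 0 < F i) ->
  exists2 r, 0 < r & forall i, r <= F i.
Proof.
move=> F0; exists (\big[Num.min/1]_i F i); last by move=> i; apply: bigmin_le_cond.
by elim/big_ind: _ => // x y x0 y0; rewrite lt_min x0.
Qed.

(** Points are picked one by one outside the finite image of the earlier ones. The induction uses
    functions on [nat] constrained below [n], which avoids changing the index type. *)
Lemma infinite_distinct (T : Type) (A : set T) n : infinite_set A ->
  exists q : 'I_n -> T, (forall k, A (q k)) /\ injective q.
Proof.
move=> Ai.
have [q [qA qi]] : exists q : nat -> T, (forall k, (k < n)%N -> A (q k)) /\
    forall j k, (j < k < n)%N -> q j <> q k.
  elim: n => [|n [q [qA qi]]].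
    have [x _] : A !=set0.
      by apply/set0P/eqP => A0; apply: Ai; rewrite A0.
    by exists (fun=> x); split=> // j k; rewrite ltn0 andbF.
  have Bi : infinite_set (A `\` (q @` `I_n)).
    by apply: infinite_setD => //; apply: finite_image; apply: finite_II.
  have [x [Ax qx]] : (A `\` (q @` `I_n)) !=set0.
    by apply/set0P/eqP => B0; apply: Bi; rewrite B0.
  exists (fun k => if (k < n)%N then q k else x); split=> [k|j k].
    by case: (ltnP k n) => [kn _|_ _ //]; exact: qA.
  move=> /andP[jk kn]; rewrite ltnS in kn; rewrite (leq_trans jk kn).
  case: ltnP => [kn'|nk]; first by apply: qi; rewrite jk.
  by move=> qjx; apply: qx; exists j => //=; apply: leq_trans kn.
exists (fun k => q k); split=> [k|j k qjk]; first exact: qA.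
apply: val_inj; have [jk|kj|//] := ltngtP (j : nat) (k : nat).
  by have := qi j k; rewrite jk ltn_ord => /(_ isT).
by have := qi k j; rewrite kj ltn_ord => /(_ isT) /(_ (esym qjk)).
Qed.

(** Removing [p0] keeps the set of cluster points infinite and makes all distances to [p0] positive.
    Taking [r] at most half of every pairwise distance makes the [r]-balls disjoint. *)
Lemma separated_points (R : realType) (M : Type) (d : M -> M -> R) (p0 : M) n :
  is_metric d -> infinite_set (cluster_points d) ->
  exists2 r, 0 < r & exists q : 'I_n -> M, [/\ forall k, cluster_points d (q k),
    forall k, r <= d p0 (q k) &
    forall j k y, d y (q j) < r -> d y (q k) < r -> j = k].
Proof.
move=> dM Mi; have [d0 dE dC dT] := dM.
have [q [qM qi]] : exists q : 'I_n -> M, (forall k, (cluster_points d `\ p0) (q k)) /\ injective q.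
  by apply: infinite_distinct; apply: infinite_setD => //; apply: finite_set1.
have [r1 r10 r1q] : exists2 r, 0 < r & forall k, r <= d p0 (q k).
  by apply: fin_lower_bound => k; apply: (metric_gt0 dM) => /esym; case: (qM k).
have [r2 r20 r2q] : exists2 r, 0 < r & forall jk : 'I_n * 'I_n,
    r <= if jk.1 == jk.2 then 1 else d (q jk.1) (q jk.2) / 2.
  apply: fin_lower_bound => -[j k] /=; case: eqVneq => // jk.
  by rewrite divr_gt0// (metric_gt0 dM)// => /qi/eqP; apply/negP.
exists (Num.min r1 r2); first by rewrite lt_min r10.
exists q; split=> [k|k|j k y]; first by case: (qM k).
  by rewrite ge_min r1q.
rewrite !lt_min => /andP[_ yj] /andP[_ yk]; apply/eqP/negP => /negP jk.
have := r2q (j, k); rewrite /= (negbTE jk).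
have := dT (q j) y (q k); rewrite (dC (q j) y); lra.
Qed.

(** * Octahedrality *)

Section SmallPerturbations.
Context {R : realType} {M : Type} (d : M -> M -> R) (p0 : M) {X : normedModType R}.
Hypothesis dM : is_metric d.
Notation F := (free_space d p0).
Notation NF := (free_norm d p0).
Notation AT := (alg_tensor (X := X) F).
Notation PN := (proj_norm (X := X) F NF).
Notation BD := (bidual_set AT PN).
Notation BN := (bidual_norm AT PN).

(** The two sides come from functionals that are compared only on the algebraic tensor product, so
    linearity of [Phi] has to be combined with [bidual_ext]. *)
Lemma bidual_form_lin Phi C1 C2 (a : R) (g1 g2 : M -> X -> R) : BD Phi -> 0 <= C1 -> 0 <= C2 ->
  lip_form d p0 C1 g1 -> lip_form d p0 C2 g2 ->
  Phi (form_functional (a *: g1 + g2)) =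
  a * Phi (form_functional g1) + Phi (form_functional g2).
Proof.
move=> PhiD C10 C20 g1C g2C; have SP := seminormed_proj (X := X) p0 dM.
have D1 := form_functional_dual dM C10 g1C.
have D2 := form_functional_dual dM C20 g2C.
rewrite -PhiD.1//; apply: (bidual_ext SP PhiD).
- by apply: (form_functional_dual dM _ (lip_form_lin a g1C g2C)); rewrite addr_ge0// mulr_ge0.
- exact: dual_set_lin.
- by move=> u; apply: form_functional_lin g1C g2C.
Qed.

Lemma bidual_form_bound Phi C (g : M -> X -> R) : BD Phi -> 0 <= C -> lip_form d p0 C g ->
  `|Phi (form_functional g)| <= BN Phi * C.
Proof.
move=> PhiD C0 gC; have SP := seminormed_proj (X := X) p0 dM.
have SD := seminormed_dual SP.
apply: le_trans (dual_norm_bound SD PhiD (form_functional_dual dM C0 gC)) _.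
rewrite ler_wpM2l ?(dual_norm_ge0 SD)//; exact: form_functional_norm.
Qed.

(** A functional almost attaining the bidual norm is represented by a Lipschitz map; the norm sees
    only [|Phi phi|], so the map is negated when the value is negative. *)
Lemma bidual_form_adherent Phi (e : R) : BD Phi -> BN Phi = 1 -> 0 < e ->
  exists2 f : M -> X -> R, lip_form d p0 1 f & 1 - e < Phi (form_functional f).
Proof.
move=> PhiD Phi1 e0; have SP := seminormed_proj (X := X) p0 dM.
have SD := seminormed_dual SP; have [D0 _ _ _] := SD.
have hs : has_sup [set `|Phi phi| | phi in [set phi | dual_set AT PN phi /\ dual_norm AT PN phi <= 1]].
  split; first by exists `|Phi 0|, 0 => //; split=> //; rewrite (seminormed0 SD).
  exists (BN Phi) => _ [phi [phiD phi1] <-]; exact: dual_norm_ge.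
have [_ [phi [phiD phi1] <-]] := sup_adherent e0 hs.
rewrite -/(dual_norm _ _ Phi) -/(bidual_norm _ _ Phi) Phi1 => ltPhi.
have [g gC phig] := dual_form_functional dM phiD.
have N0 := dual_norm_ge0 SP phiD.
have g1 : lip_form d p0 1 g.
  case: gC => gl gz gb; split=> // p q x; apply: le_trans (gb p q x) _.
  by rewrite ler_wpM2r// ler_wpM2r//; case: dM.
have gD := form_functional_dual dM ler01 g1.
have Phig : Phi phi = Phi (form_functional g).
  exact: (bidual_ext SP PhiD phiD gD).
have [P0|P0] := leP 0 (Phi phi).
  by exists g => //; rewrite -Phig; rewrite ger0_norm in ltPhi.
have lip0 : lip_form d p0 0 (0 : M -> X -> R).
  by split=> [p a x y|//|p q x]; rewrite ?mulr0 ?addr0// subrr normr0 !mul0r.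
exists ((-1) *: g + 0).
  by have := lip_form_lin (-1) g1 lip0; rewrite normrN1 mul1r addr0.
rewrite (bidual_form_lin _ PhiD ler01 (lexx _) g1 lip0) -Phig.
have := bidual_form_bound PhiD (lexx _) lip0; rewrite mulr0 normr_le0 => /eqP ->.
by rewrite ltr0_norm in ltPhi; rewrite // mulN1r addr0.
Qed.

Lemma sum_In_le (T : Type) (xs : seq T) (G : T -> R) x : (forall x, 0 <= G x) ->
  List.In x xs -> G x <= \sum_(y <- xs) G y.
Proof.
move=> G0; elim: xs => [[]|y xs IH] /= [->|/IH xle]; rewrite big_cons.
  by rewrite lerDl sumr_ge0.
by apply: le_trans xle _; rewrite lerDr.
Qed.

Lemma sum_In_bound (T : Type) (xs : seq T) (G : T -> R) (c : R) :
  (forall x, List.In x xs -> G x <= c) -> \sum_(y <- xs) G y <= c *+ size xs.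
Proof.
elim: xs => [_|y xs IH xc]; first by rewrite big_nil mulr0n.
rewrite big_cons mulrS lerD//; first by apply: xc; left.
by apply: IH => x x_xs; apply: xc; right.
Qed.

Lemma exists_le_average n (G : 'I_n -> R) (c e : R) : c < n%:R * e ->
  \sum_(k < n) G k <= c -> exists k, G k < e.
Proof.
move=> cn Gc; apply/not_existsP => Ge.
suff : n%:R * e <= c by rewrite leNgt cn.
apply: le_trans Gc; rewrite -[n in n%:R]card_ord -sum1_card natr_sum mulr_suml.
by apply: ler_sum => k _; rewrite mul1r leNgt; apply/negP/Ge.
Qed.

(* The perturbations at the points of a large finite set of cluster points have
   disjoint supports, so at one of these points all of them are almost
   annihilated by the given bidual elements. *)
Lemma common_perturbation (Phis : seq (((((((M -> R) -> R) -> X -> R) -> R) -> R)) -> R))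
    (e : R) (xs : X -> R) :
  infinite_set (cluster_points d) -> 0 < e ->
  (forall (a : R) x y, xs (a *: x + y) = a * xs x + xs y) ->
  (forall x, `|xs x| <= `|x|) ->
  (forall Phi, List.In Phi Phis -> BD Phi /\ BN Phi = 1) ->
  exists p v, p <> v /\ forall Phi, List.In Phi Phis -> exists h : M -> X -> R,
    [/\ lip_form d p0 (1 + e) h, forall x, h p x - h v x = d p v * xs x &
      1 - 2 * e < Phi (form_functional h)].
Proof.
move=> Mi e0 xsl xs1 PhisD; have [d0 dE dC dT] := dM.
(* Choice is made over all [Phi], with 0 as default outside the list. *)
have /choice[f fP] : forall Phi, exists f : M -> X -> R, List.In Phi Phis ->
    lip_form d p0 1 f /\ 1 - e < Phi (form_functional f).
  move=> Phi.
  have [inP|nP] := pselect (List.In Phi Phis); last by exists 0.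
  have [PhiD Phi1] := PhisD _ inP.
  by have [g g1 ltg] := bidual_form_adherent PhiD Phi1 e0; exists g.
pose C : R := `|-1| * 1 + (1 + e).
have C0 : 0 <= C by rewrite addr_ge0 ?mulr_ge0 ?addr_ge0// ltW.
(* [c] bounds the double sum of [|Phi (form_functional (g Phi k))|] over the list and over [k], for
   any number of points; [n] is taken so large that the average over [k] is below [e]. *)
pose c := (2 * C) *+ size Phis; pose n := Num.bound (c / e).
have cn : c < n%:R * e.
  by rewrite -ltr_pdivrMr// archi_boundP// divr_ge0 ?(ltW e0)// mulrn_wge0// mulr_ge0.
have [r r0 [q [qM rq qr]]] := separated_points p0 n dM Mi.
have [b b0 bP] := perturbation p0 dM r0 e0 xsl xs1.
have /choice[h hP] : forall Pk : _ * 'I_n, exists h : M -> X -> R, List.In Pk.1 Phis ->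
    [/\ lip_form d p0 (1 + e) h,
      forall y, r <= d y (q Pk.2) -> h y = f Pk.1 y &
      forall v x, d v (q Pk.2) < b -> h (q Pk.2) x - h v x = d v (q Pk.2) * xs x].
  move=> [Phi k] /=; have [inP|nP] := pselect (List.In Phi Phis); last by exists 0.
  by have [h hP] := bP (q k) (f Phi) (rq k) (fP _ inP).1; exists h.
pose g Phi k := (-1) *: f Phi + h (Phi, k).
have gC Phi k : List.In Phi Phis -> lip_form d p0 C (g Phi k).
  move=> inP; have [hL _ _] := hP (Phi, k) inP.
  exact: lip_form_lin (fP _ inP).1 hL.
have small Phi : List.In Phi Phis ->
    \sum_(k < n) `|Phi (form_functional (g Phi k))| <= 2 * C.
  move=> inP; have [PhiD Phi1] := PhisD _ inP.
  apply: (@sum_disjoint_le _ _ d p0 _ dM n C (fun g => Phi (form_functional g)) (g Phi)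
    (fun k y => d y (q k) < r)) => //.
  - by move=> C1 C2 a g1 g2; apply: bidual_form_lin.
  - move=> C1 g1 C10 g1C; rewrite -[leRHS]mul1r -Phi1.
    exact: bidual_form_bound.
  - by move=> k; apply: gC.
  - move=> k y /negP; rewrite -leNgt => ry; have [_ hf _] := hP (Phi, k) inP.
    by apply/funext => x; rewrite /g !fctE hf//= scaleN1r addNr.
have [k kP] : exists k, \sum_(Phi <- Phis) `|Phi (form_functional (g Phi k))| < e.
  apply: (exists_le_average cn); rewrite exchange_big /=.
  exact: sum_In_bound.
have [v [vq vb]] := qM k b b0.
exists (q k), v; split=> [/esym//|Phi inP].
have [hL _ hx] := hP (Phi, k) inP; exists (h (Phi, k)); split=> //.
  by move=> x; rewrite hx 1?dC.
have [PhiD _] := PhisD _ inP; have [fL ltf] := fP _ inP.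
(* [f Phi] contributes more than [1 - e] and the difference [g Phi k] costs less than [e]. *)
have -> : h (Phi, k) = 1 *: g Phi k + f Phi.
  by rewrite scale1r /g scaleN1r addrAC addNr add0r.
rewrite (bidual_form_lin _ PhiD C0 ler01 (gC _ _ inP) fL) mul1r.
have := @sum_In_le _ Phis (fun Phi => `|Phi (form_functional (g Phi k))|) Phi
  (fun _ => normr_ge0 _) inP.
have := ler_norm (- Phi (form_functional (g Phi k))); rewrite normrN; lra.
Qed.

End SmallPerturbations.

Theorem theorem4p4 (R : realType) (M : Type) (d : M -> M -> R) (p0 : M)
    (X : completeNormedModType R) :
  is_metric d ->
  ~ finite_set (cluster_points d) ->
  (exists x : X, x != 0) ->
  octahedral
    (bidual_set (alg_tensor (X:=X) (free_space d p0))
                (proj_norm (X:=X) (free_space d p0) (free_norm d p0)))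
    (bidual_norm (alg_tensor (X:=X) (free_space d p0))
                 (proj_norm (X:=X) (free_space d p0) (free_norm d p0))).
Proof.
move=> dM Mi [x1 x1n0] Phis e e0 PhisD; have [d0 dE dC dT] := dM.
set F := free_space d p0; set NF := free_norm d p0.
set AT := alg_tensor F; set PN := proj_norm F NF.
have SF : seminormed F NF := seminormed_free p0 dM.
have SP : seminormed AT PN := seminormed_proj p0 dM.
have SD := seminormed_dual SP; have SB := seminormed_dual SD.
pose x0 : X := `|x1|^-1 *: x1.
have x01 : `|x0| = 1.
  by rewrite normrZ ger0_norm ?invr_ge0// mulVf// normr_eq0.
have [xs [xsl xs1 xsx0]] := norming_functional x0.
(* With [e / 4] the final estimate reads [2 - e / 2 < K * (1 + e / 4)], where [K] is the norm of
   [Phi - y]; this gives [2 - e <= K]. *)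
have e40 : 0 < e / 4 by rewrite divr_gt0.
have [p [v [pv hP]]] := common_perturbation dM Mi e40 xsl xs1 PhisD.
have dpv : 0 < d p v by apply: metric_gt0 dM _ _ pv.
pose m : (M -> R) -> R := (d p v)^-1 *: (delta p - delta v).
have Fdd : F (delta p - delta v).
  by apply: (seminormedB SF); apply: delta_free.
have Fm : F m by apply: (seminormedZ _ SF).
pose t : (((M -> R) -> R) -> X -> R) -> R := tens F [:: (m, x0)].
have tT : AT t by apply: alg_tensor1.
have t1 : PN t <= 1.
  apply: le_trans (proj_norm1 SF x0 Fm) _; rewrite x01 mulr1.
  have [_ _ _ NZ] := SF; apply: le_trans (NZ _ _ Fdd) _.
  rewrite ger0_norm ?invr_ge0 ?(ltW dpv)// ler_pdivrMl// mulr1.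
  exact: free_norm_deltaB.
have tform (C : R) (h : M -> X -> R) : lip_form d p0 C h ->
    (forall x, h p x - h v x = d p v * xs x) -> form_functional h t = 1.
  move=> hL hx; rewrite (form_functional_tens _ hL) big_seq1 /= /m !fctE /delta.
  by rewrite hx /GRing.scale /= mulrA mulVf ?mul1r ?xsx0 ?x01// gt_eqF.
(* The minus sign makes [Phi - y] add the value 1 at [t] to [Phi (form_functional h)]. *)
pose y : (((((M -> R) -> R) -> X -> R) -> R) -> R) -> R := fun phi => - phi t.
have yb phi : dual_set AT PN phi -> `|y phi| <= 1 * dual_norm AT PN phi.
  move=> phiD; rewrite /y normrN mul1r; exact: dual_norm_ge.
have yD : bidual_set AT PN y.
  by split; [move=> a u w _ _; rewrite /y !fctE /GRing.scale /=; ring|exists 1].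
exists y; split=> //; split.
  apply/eqP; rewrite eq_le; apply/andP; split; first by apply: dual_norm_le.
  (* The distance to [v], normalised at [p0] and multiplied by [xs], is a norm-one test map on which
     [t] takes the value 1; hence [y] has norm at least 1. *)
  pose h z (x : X) := (d z v - d p0 v) * xs x.
  have hL : lip_form d p0 1 h.
    split=> [z a x x'|x|z w x]; rewrite /h; first by rewrite xsl; ring.
      by rewrite subrr mul0r.
    rewrite -mulrBl opprB addrA subrK normrM mul1r ler_pM// ler_norml.
    have := dT z w v; have := dT w z v; rewrite (dC w z) => ? ?.
    by apply/andP; split; lra.
  have hx x : h p x - h v x = d p v * xs x.
    by rewrite /h (_ : d v v = 0); [ring|apply/dE].
  have hD := form_functional_dual dM ler01 hL.
  have := dual_norm_bound SD yD hD.
  rewrite /y (tform _ _ hL hx) normrN1 => /le_trans; apply.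
  rewrite -[leRHS]mulr1 ler_wpM2l ?(dual_norm_ge0 SD)//.
  exact: form_functional_norm.
move=> Phi inP; have [PhiD Phi1] := PhisD _ inP.
have [h [hL hx ltPhi]] := hP _ inP.
have e41 : 0 <= 1 + e / 4 by rewrite addr_ge0// ltW.
have hD := form_functional_dual dM e41 hL.
have PyD : bidual_set AT PN (Phi - y) by apply: (seminormedB SB).
have := dual_norm_bound SD PyD hD.
have PyN := dual_norm_ge0 SD PyD.
have : dual_norm (dual_set AT PN) (dual_norm AT PN) (Phi - y) * dual_norm AT PN (form_functional h)
    <= dual_norm (dual_set AT PN) (dual_norm AT PN) (Phi - y) * (1 + e / 4).
  by rewrite ler_wpM2l//; apply: form_functional_norm.
have -> : (Phi - y) (form_functional h) = Phi (form_functional h) + 1.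
  by rewrite !fctE /y (tform _ _ hL hx) opprK.
have := ler_norm (Phi (form_functional h) + 1).
rewrite /bidual_norm; set K := dual_norm _ _ (Phi - y); move: K PyN => K; nra.
Qed.
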